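(* Let $q$ be a power of a prime $p\ne 7$ and let $a\in\mathbb F_q$ be such that $f=X^7+X^6+a\in\mathbb F_q[X]$ is irreducible. If $\theta_{7,7}(1,0,0,0,0,0,a)\ne 0$ (evaluated in $\mathbb F_q$), then $f$ is normal over $\mathbb F_q$.
   Context: A monic irreducible polynomial of degree $n$ over $\mathbb F_q$ is called normal if its roots are linearly independent over $\mathbb F_q$. Let $\epsilon_7=e^{2\pi\sqrt{-1}/7}$ and $\Psi_7(X_0,\dots,X_6)=\prod_{i\in(\mathbb Z/7\mathbb Z)^\times}\bigl(\sum_{j\in\mathbb Z/7\mathbb Z}\epsilon_7^{ij}X_j\bigr)\in\mathbb Z[X_0,\dots,X_6]$. Let the symmetric group $S_7$ act on $\mathbb Z[X_0,\dots,X_6]$ by permuting the indeterminates, and define $\Theta_{7,7}=\prod_\phi\phi(\Psi_7)$, where $\phi$ runs over a left transversal of the stabilizer of $\Psi_7$ in $S_7$; this is a symmetric polynomial in $\mathbb Z[X_0,\dots,X_6]$. Let $\theta_{7,7}\in\mathbb Z[s_1,\dots,s_7]$ be its symmetric reduction, i.e. the unique polynomial with $\Theta_{7,7}(X_0,\dots,X_6)=\theta_{7,7}(s_1,\dots,s_7)$, where $s_i$ is the $i$-th elementary symmetric polynomial in $X_0,\dots,X_6$. Evaluation of $\theta_{7,7}$ at elements of $\mathbb F_q$ is done after reducing its integer coefficients modulo $p$. *)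

(* Defs.v *)
From HB Require Import structures.
From mathcomp Require Import all_boot all_order all_algebra all_fingroup all_field.
From mathcomp Require Import mpoly.
From Stdlib Require Import ClassicalEpsilon.
Set Implicit Arguments.
Unset Strict Implicit.
Unset Printing Implicit Defensive.
Import Order.TTheory GRing.Theory Num.Theory.
Local Open Scope ring_scope.

(* eps7 = e^{2 pi i/7}: 7.-root (-1) is the 7th root of -1 of minimal
   nonnegative argument, i.e. e^{i pi/7}; its square is e^{2 i pi/7}. *)
Definition eps7 : algC := (7.-root (-1)) ^+ 2.

Definition Psi7 : {mpoly algC[7]} :=
  \prod_(i < 7 | i != ord0) \sum_(j < 7) (eps7 ^+ (i * j)) *: 'X_j.

(* Theta_{7,7} = prod over a transversal of Stab(Psi7) in S_7 of phi(Psi7)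
   = product of the distinct elements of the S_7-orbit of Psi7, where
   phi acts by permuting the indeterminates (msym s : X_i |-> X_(s i)). *)
Definition Theta77 : {mpoly algC[7]} :=
  \prod_(P <- undup [seq msym s Psi7 | s <- enum [set: 'S_7]]) P.

Definition esyms7 : 7.-tuple {mpoly algC[7]} :=
  [tuple mesym 7 algC i.+1 | i < 7].

Definition is_theta77 (t : {mpoly int[7]}) : Prop :=
  (map_mpoly (fun z : int => z%:~R : algC) t) \mPo esyms7 = Theta77.

Definition theta77 : {mpoly int[7]} :=
  epsilon (inhabits 0) is_theta77.

Definition theta77_eval (F : fieldType) (v : 'I_7 -> F) : F :=
  (map_mpoly (fun z : int => z%:~R : F) theta77).@[v].

Definition pt_1_a (F : fieldType) (a : F) : 'I_7 -> F :=
  fun i => if val i == 0%N then 1 else if val i == 6%N then a else 0.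

Definition normal_poly (F : fieldType) (f : {poly F}) : Prop :=
  forall (L : fieldExtType F) (rs : seq L),
    map_poly (in_alg L) f = \prod_(r <- rs) ('X - r%:P) -> free rs.

(* Main.v *)
(** The product Psi of the n - 1 nontrivial resolvents sum_j z^(ij) X_j has
    integer coefficients that do not depend on the root z of
    1 + X + ... + X^(n-1), so theta_{7,7} specialises to any field containing
    such a z. The roots of f form one Frobenius orbit r_j = r^(q^j). At the
    points -r_j the elementary symmetric polynomials take the values
    (1,0,...,0,a), so the hypothesis on theta says that Psi(-r_0,...,-r_6) and
    its conjugates do not vanish, while the trivial resolvent is
    r_0 + ... + r_6 = -1. Applying the powers of Frobenius to a linear relation
    sum_j c_j r_j = 0 and taking discrete Fourier transforms gives
    C(z^-i) R_i = 0 with C = sum_j c_j X^j and R_i the i-th resolvent; hence C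
    has seven roots and is zero. *)

Require Import Defs.
From HB Require Import structures.
From mathcomp Require Import all_boot all_order all_algebra all_fingroup all_field.
From mathcomp Require Import mpoly.
From Stdlib Require Import ClassicalEpsilon.
Set Implicit Arguments.
Unset Strict Implicit.
Unset Printing Implicit Defensive.
Import GRing.Theory Num.Theory.
Local Open Scope ring_scope.

(** * Products of resolvents over an arbitrary ring *)

(** For prime [n] the condition [0 < i] selects the units modulo [n]. Leaving [R] and [z] free lets
    the same formula serve a variable, a complex root of unity and a root of unity in positive
    characteristic. *)
Definition resolvent_prod (n : nat) (R : comNzRingType) (z : R)
    (v : 'I_n -> R) : R :=
  \prod_(i < n | (0 < i)%N) \sum_(j < n) z ^+ (i * j) * v j.

Lemma rmorph_resolvent_prod (n : nat) (R S : comNzRingType)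
    (f : {rmorphism R -> S}) (z : R) (v : 'I_n -> R) :
  f (resolvent_prod z v) = resolvent_prod (f z) (f \o v).
Proof.
rewrite rmorph_prod; apply: eq_bigr => i _.
by rewrite rmorph_sum; apply: eq_bigr => j _; rewrite rmorphM rmorphXn.
Qed.

(** Multiplication by [k] permutes the residues modulo [n] and fixes 0, so replacing [z] by its
    [k]-th power only reorders the factors. *)
Lemma resolvent_prod_expr (n : nat) (R : comNzRingType) (z : R)
    (v : 'I_n -> R) (k : nat) :
  z ^+ n = 1 -> coprime n k -> resolvent_prod (z ^+ k) v = resolvent_prod z v.
Proof.
move=> zn1 co_nk; have [n0|n_gt0] := posnP n.
  by subst n; rewrite /resolvent_prod !big_ord0.
pose h (i : 'I_n) := Ordinal (ltn_pmod (k * i) n_gt0).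
have h_inj : injective h.
  suff le_h (i j : 'I_n) : (i <= j)%N -> h i = h j -> i = j.
    move=> i j hij; have [/le_h|/ltnW/le_h] := leqP i j; first exact.
    by move/(_ (esym hij)).
  move=> le_ij /(congr1 val) /= /esym/eqP.
  rewrite eqn_mod_dvd ?leq_mul2l ?le_ij ?orbT // -mulnBr Gauss_dvdr //.
  rewrite /dvdn modn_small ?(leq_ltn_trans (leq_subr _ _)) // subn_eq0 => le_ji.
  by apply/val_inj/eqP; rewrite eqn_leq le_ij.
rewrite /resolvent_prod [RHS](reindex_inj h_inj) /=.
apply: eq_big => [i|i _].
  by rewrite !lt0n -/(dvdn n (k * i)) Gauss_dvdr // /dvdn modn_small.
apply: eq_bigr => j _; congr (_ * _).
rewrite -exprM -(expr_mod _ zn1) -(expr_mod (_ %% n * j) zn1).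
by rewrite modnMml mulnA.
Qed.

Lemma expr_geom_sum_eq0 (n : nat) (R : comNzRingType) (z : R) :
  \sum_(i < n) z ^+ i = 0 -> z ^+ n = 1.
Proof. by move=> z0; apply/eqP; rewrite -subr_eq0 subrX1 z0 mulr0. Qed.

Lemma geom_sum_prim_root (n : nat) (R : idomainType) (w : R) (k : nat) :
  n.-primitive_root w -> (0 < k < n)%N -> \sum_(i < n) (w ^+ k) ^+ i = 0.
Proof.
move=> w_prim /andP[k_gt0 k_lt].
have: (w ^+ k - 1) * \sum_(i < n) (w ^+ k) ^+ i = 0.
  by rewrite -subrX1 exprAC (prim_expr_order w_prim) expr1n subrr.
move/eqP; rewrite mulf_eq0 subr_eq0 -(prim_order_dvd w_prim).
by rewrite /dvdn modn_small // eqn0Ngt k_gt0 => /eqP.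
Qed.

Lemma map_mpoly_inj (m : nat) (R S : nzRingType) (f : {rmorphism R -> S}) :
  injective f -> injective (map_mpoly (n := m) f).
Proof.
move=> f_inj p q epq; apply/mpolyP => mu; apply: f_inj.
by rewrite -!mcoeff_map_mpoly epq.
Qed.

(* Divide the generic resolvent product, a polynomial in a variable 'X standing
   for z, by Phi = 1 + 'X + ... + 'X^(n-1). The remainder takes the same value
   at all n - 1 primitive complex roots of unity, so it is constant: it is P. *)
Lemma resolvent_prod_int (n : nat) : prime n -> exists P : {mpoly int[n]},
  forall (R : comNzRingType) (z : R), \sum_(i < n) z ^+ i = 0 ->
    map_mpoly intr P = resolvent_prod z%:MP (fun j => 'X_j) :> {mpoly R[n]}.
Proof.
move=> n_prime; pose A := {mpoly int[n]}.
have n_gt0 := prime_gt0 n_prime.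
pose Q : {poly A} := resolvent_prod 'X (fun j => ('X_j)%:P).
pose Phi : {poly A} := \poly_(i < n) 1.
have Phi_lead : 1 != 0 :> A by rewrite oner_eq0.
have Phi_monic : Phi \is monic by rewrite monicE lead_coef_poly.
have size_Phi : size Phi = n by rewrite size_poly_eq.
set Rm := Pdiv.CommonRing.rmodp Q Phi.
have size_Rm : (size Rm < n)%N.
  have Phi_neq0 : Phi != 0 by apply: monic_neq0.
  by rewrite -[X in (_ < X)%N]size_Phi Pdiv.CommonRing.ltn_rmodp.
have RmE (R : comNzRingType) (z : R) : \sum_(i < n) z ^+ i = 0 ->
    (map_poly (map_mpoly intr) Rm).[z%:MP] =
      resolvent_prod z%:MP (fun j => 'X_j) :> {mpoly R[n]}.
  move=> z0.
  have com : commr_rmorph (map_mpoly (n := n) (intr : int -> R)) z%:MP.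
    by move=> x; apply: mulrC.
  have PhiE : horner_morph com Phi = 0.
    rewrite /Phi poly_def rmorph_sum /=.
    transitivity ((\sum_(i < n) z ^+ i)%:MP : {mpoly R[n]}).
      rewrite rmorph_sum; apply: eq_bigr => i _.
      by rewrite scale1r rmorphXn /= horner_morphX -rmorphXn.
    by rewrite z0 rmorph0.
  rewrite -[LHS]/(horner_morph com Rm).
  have := congr1 (horner_morph com) (Pdiv.RingMonic.rdivp_eq Phi_monic Q).
  rewrite rmorphD rmorphM /= PhiE mulr0 add0r => <-.
  rewrite rmorph_resolvent_prod /= horner_morphX.
  apply: eq_bigr => i _; apply: eq_bigr => j _ /=.
  by rewrite horner_morphC /= map_mpolyX.
have [w w_prim] := C_prim_root_exists n_gt0.
have Rm_const : map_poly (map_mpoly intr) Rm =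
    (resolvent_prod w%:MP (fun j => 'X_j))%:P :> {poly {mpoly algC[n]}}.
  apply/eqP; rewrite -subr_eq0; set D := _ - _; apply/negPn/negP => D_neq0.
  (* These are [n - 1] distinct roots, while [D] has size at most [n - 1], hence degree at most
     [n - 2]. *)
  pose rs : seq {mpoly algC[n]} := [seq (w ^+ k)%:MP | k <- iota 1 n.-1].
  have rs_uniq : uniq rs.
    rewrite map_inj_in_uniq ?iota_uniq // => i j.
    rewrite !mem_iota add1n prednK // => /andP[_ ilt] /andP[_ jlt].
    move/eqP; rewrite mpolyC_eq (eq_prim_root_expr w_prim) !modn_small //.
    by move/eqP.
  have D_roots : all (root D) rs.
    apply/allP => _ /mapP[k + ->]; rewrite mem_iota add1n prednK // => k_lt.
    rewrite /root hornerD hornerN hornerC RmE ?(geom_sum_prim_root w_prim) //.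
    rewrite rmorphXn /= resolvent_prod_expr ?subrr //.
      by rewrite -rmorphXn /= (prim_expr_order w_prim) rmorph1.
    by rewrite prime_coprime // gtnNdvd //; case/andP: k_lt.
  have := max_poly_roots D_neq0 D_roots rs_uniq.
  rewrite size_map size_iota ltnNge => /negP; apply.
  rewrite (leq_trans (size_polyD _ _)) // geq_max size_polyN.
  rewrite (leq_trans (size_poly _ _)) -ltnS ?prednK //=.
  by rewrite (leq_ltn_trans (size_polyC_leq1 _)) // prime_gt1.
exists Rm`_0 => R z z0; rewrite -RmE //.
suff -> : Rm = (Rm`_0)%:P by rewrite map_polyC hornerC coefC.
(* The higher coefficients vanish over [algC], hence already over [int], which embeds in it. *)
apply/polyP => -[|i]; rewrite coefC //=.
apply: (@map_mpoly_inj _ _ algC (intr : int -> algC)); first exact: intr_inj.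
by rewrite raddf0 -coef_map Rm_const coefC.
Qed.

(** * Orbit products and theta over the integers *)

Definition orbit_prod (n : nat) (R : comNzRingType) (P : {mpoly R[n]}) :
    {mpoly R[n]} :=
  \prod_(Q <- undup [seq msym s P | s <- enum [set: 'S_n]]) Q.

Lemma msym_map_mpoly (n : nat) (R S : nzRingType) (f : {rmorphism R -> S})
    (s : 'S_n) (p : {mpoly R[n]}) :
  msym s (map_mpoly f p) = map_mpoly f (msym s p).
Proof.
by apply/mpolyP => m; rewrite mcoeff_sym !mcoeff_map_mpoly mcoeff_sym.
Qed.

(** Injectivity keeps distinct conjugates of [P] distinct, so [undup] discards the same repetitions
    on both sides. *)
Lemma map_orbit_prod (n : nat) (R S : comNzRingType) (f : {rmorphism R -> S})
    (P : {mpoly R[n]}) :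
  injective f -> map_mpoly f (orbit_prod P) = orbit_prod (map_mpoly f P).
Proof.
move=> f_inj; rewrite /orbit_prod rmorph_prod -(big_map (map_mpoly f) xpredT id).
rewrite -undup_map_inj; last exact: map_mpoly_inj.
by rewrite -map_comp (eq_map (fun s => esym (msym_map_mpoly f s P))).
Qed.

(** Applying [msym t] permutes the distinct elements of the orbit. *)
Lemma orbit_prod_sym (n : nat) (R : comNzRingType) (P : {mpoly R[n]}) :
  orbit_prod P \is symmetric.
Proof.
apply/issymP => t; rewrite /orbit_prod rmorph_prod -(big_map (msym t) xpredT id).
apply/perm_big/uniq_perm; rewrite ?undup_uniq //.
  by rewrite map_inj_uniq ?undup_uniq //; apply: inj_msym.
move=> Q; rewrite -undup_map_inj; last exact: inj_msym.
rewrite !mem_undup -map_comp; apply/mapP/mapP => [] [s _ ->].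
  by exists (s * t)%g; rewrite ?mem_enum ?inE //= msymMm.
by exists (s * t^-1)%g; rewrite ?mem_enum ?inE //= -msymMm mulgKV.
Qed.

Lemma map_mpoly_mesym (n k : nat) (R S : nzRingType) (f : {rmorphism R -> S}) :
  map_mpoly f (mesym n R k) = mesym n S k.
Proof.
by apply/mpolyP => m; rewrite mcoeff_map_mpoly !mcoeff_mesym /= rmorph_nat.
Qed.

Lemma geom_sum_eps7 : \sum_(i < 7) eps7 ^+ i = 0.
Proof.
have eps7_7 : eps7 ^+ 7 = 1 by rewrite /eps7 exprAC rootCK // sqrrN expr1n.
have /eqP : (eps7 - 1) * \sum_(i < 7) eps7 ^+ i = 0.
  by rewrite -subrX1 eps7_7 subrr.
rewrite mulf_eq0 subr_eq0 => /predU1P[/eqP|/eqP //].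
(* If [eps7] were 1, the chosen 7th root of -1 would be 1 or -1; the first is not a root of
   [X^7 + 1], and the second is negative, which [n.-root] never is for [n > 1]. *)
rewrite /eps7 sqrf_eq1 => /orP[|/eqP r_eq].
  by rewrite rootC_eq1 // eqNr oner_eq0.
by have := rootC_lt0 (-1 : algC) (isT : (1 < 7)%N); rewrite r_eq ltrN10.
Qed.

Lemma Psi7E : Psi7 = resolvent_prod eps7%:MP (fun j => 'X_j).
Proof.
apply: eq_big => [i|i _]; first by rewrite lt0n.
by apply: eq_bigr => j _; rewrite -mul_mpolyC rmorphXn.
Qed.

(** The identity defining [theta77] over [algC] descends to [int], and from there it can be reduced
    in any commutative ring. *)
Lemma theta77_comp : exists P : {mpoly int[7]},
  (forall (R : comNzRingType) (z : R), \sum_(i < 7) z ^+ i = 0 ->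
    map_mpoly intr P = resolvent_prod z%:MP (fun j => 'X_j) :> {mpoly R[7]}) /\
  theta77 \mPo [tuple mesym 7 int i.+1 | i < 7] = orbit_prod P.
Proof.
have [P PE] := @resolvent_prod_int 7 isT; exists P; split=> //.
have intC_inj : injective (intr : int -> algC) by apply: intr_inj.
have ThetaE : Theta77 = map_mpoly intr (orbit_prod P).
  by rewrite map_orbit_prod // (PE _ _ geom_sum_eps7) -Psi7E.
have esymsE : [tuple of [seq map_mpoly (intr : int -> algC) q
    | q <- [tuple mesym 7 int i.+1 | i < 7]]] = esyms7.
  by apply: eq_from_tnth => i; rewrite tnth_map !tnth_mktuple map_mpoly_mesym.
have is_theta t : is_theta77 t <->
    t \mPo [tuple mesym 7 int i.+1 | i < 7] = orbit_prod P.
  rewrite /is_theta77 ThetaE -esymsE.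
  rewrite -[map_mpoly (fun _ => _) t]/(map_mpoly intr t) -map_mpoly_comp //.
  by split=> [/(map_mpoly_inj intC_inj)|->].
(* The choice made by [epsilon] is meaningful once some integral reduction exists; the fundamental
   theorem of symmetric polynomials over [int] supplies one. *)
apply/is_theta; apply: epsilon_spec.
by have [t [tE _]] := sym_fundamental (orbit_prod_sym P); exists t; apply/is_theta.
Qed.

(** * Specialisation of theta to a field *)

Lemma meval_map_comp_mpoly (n k : nat) (R S : comNzRingType)
    (f : {rmorphism R -> S}) (p : {mpoly R[n]}) (lq : n.-tuple {mpoly R[k]})
    (v : 'I_k -> S) :
  (map_mpoly f (p \mPo lq)).@[v] =
    (map_mpoly f p).@[fun i => (map_mpoly f (tnth lq i)).@[v]].
Proof.
rewrite comp_mpolyEX [in RHS](mpolyE p) !(raddf_sum (map_mpoly f)).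
rewrite !(raddf_sum (meval _)); apply: eq_bigr => m _ /=.
rewrite !map_mpolyZ !mevalZ map_mpolyX comp_mpolyX mevalX !rmorph_prod.
by congr (_ * _); apply: eq_bigr => i _; rewrite !rmorphXn.
Qed.

Lemma meval_resolvent_prod (n : nat) (R : comNzRingType) (z : R) (v : 'I_n -> R) :
  (resolvent_prod z%:MP (fun j => 'X_j)).@[v] = resolvent_prod z v.
Proof.
rewrite (rmorph_resolvent_prod (meval v)) /= mevalC.
by apply: eq_bigr => i _; apply: eq_bigr => j _ /=; rewrite mevalXU.
Qed.

(** At the elementary symmetric values of [v], theta is the product of the conjugates of [P]
    evaluated at [v]. The identity permutation contributes the factor [resolvent_prod z v], so theta
    vanishes with it. *)
Lemma theta77_mesym_neq0 (K : fieldType) (z : K) (v : 'I_7 -> K) :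
    \sum_(i < 7) z ^+ i = 0 ->
    theta77_eval (fun i => (mesym 7 K i.+1).@[v]) != 0 ->
  resolvent_prod z v != 0.
Proof.
move=> z0; apply: contraNneq => r0.
have [P [PE thetaE]] := theta77_comp.
rewrite /theta77_eval -[map_mpoly (fun _ => _) _]/(map_mpoly intr theta77).
have -> : (map_mpoly intr theta77).@[fun i => (mesym 7 K i.+1).@[v]] =
    (map_mpoly intr (orbit_prod P)).@[v].
  rewrite -thetaE meval_map_comp_mpoly; apply: meval_eq => i.
  by rewrite tnth_mktuple map_mpoly_mesym.
rewrite /orbit_prod !rmorph_prod prodf_seq_eq0; apply/hasP.
exists P.
  by rewrite mem_undup; apply/mapP; exists 1%g; rewrite ?mem_enum ?inE ?msym1m.
by rewrite /= (PE _ _ z0) meval_resolvent_prod r0.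
Qed.

(** * Discrete Fourier transform of a linear relation *)

Lemma big_ord_shift (R : Type) (idx : R) (op : Monoid.com_law idx) (n : nat)
    (E : nat -> R) (k : nat) :
  (forall m, E (m + n)%N = E m) ->
  \big[op/idx]_(i < n) E (i + k)%N = \big[op/idx]_(i < n) E i.
Proof.
move=> E_per; elim: k => [|k IHk].
  by apply: eq_bigr => i _; rewrite addn0.
rewrite -{}IHk; case: n E_per => [|n] E_per; first by rewrite !big_ord0.
rewrite big_ord_recr [RHS]big_ord_recl /= Monoid.mulmC; congr (op _ _).
  by rewrite addnS -addSn addnC E_per.
by apply: eq_bigr => i _; rewrite /bump /= addnS addSnnS.
Qed.

Lemma resolvents_neq0_kernel (K : fieldType) (n : nat) (z : K)
    (c : 'I_n -> K) (x : nat -> K) :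
    n.-primitive_root z ->
    (forall m, x (m + n)%N = x m) ->
    (forall k, \sum_(j < n) c j * x (j + k)%N = 0) ->
    (forall i : 'I_n, \sum_(m < n) z ^+ (i * m) * x m != 0) ->
  forall j, c j = 0.
Proof.
move=> z_prim x_per cx0 res_neq0 j.
have n_gt0 := prim_order_gt0 z_prim.
have z_neq0 : z != 0.
  apply: contra_eq_neq (prim_expr_order z_prim) => ->.
  by rewrite expr0n gtn_eqF // eq_sym oner_eq0.
pose C : {poly K} := \poly_(i < n) (if insub i is Some j then c j else 0).
have CE y : C.[y] = \sum_(j < n) c j * y ^+ j.
  by rewrite horner_poly; apply: eq_bigr => i _; rewrite valK.
suff C0 : C = 0.
  have := congr1 (fun p : {poly K} => p`_j) C0.
  by rewrite coef_poly coef0 ltn_ord valK.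
apply/eqP/negPn/negP => C_neq0.
pose rs := [seq (z ^+ i)^-1 | i <- iota 0 n].
have rs_uniq : uniq rs.
  rewrite map_inj_in_uniq ?iota_uniq // => i k; rewrite !mem_iota !add0n /=.
  move=> ilt klt /invr_inj/eqP.
  by rewrite (eq_prim_root_expr z_prim) !modn_small // => /eqP.
suff /(max_poly_roots C_neq0)/(_ rs_uniq) : all (root C) rs.
  by rewrite size_map size_iota ltnNge size_poly.
apply/allP => _ /mapP[i + ->]; rewrite mem_iota add0n => /andP[_ i_lt].
have /eqP : \sum_(k < n) z ^+ (i * k) * \sum_(j < n) c j * x (j + k)%N = 0.
  by apply: big1 => k _; rewrite cx0 mulr0.
suff -> : \sum_(k < n) z ^+ (i * k) * \sum_(j < n) c j * x (j + k)%N =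
    C.[(z ^+ i)^-1] * \sum_(m < n) z ^+ (i * m) * x m.
  by rewrite mulf_eq0 (negPf (res_neq0 (Ordinal i_lt))) orbF.
rewrite CE mulr_suml; under eq_bigr do rewrite mulr_sumr.
rewrite exchange_big; apply: eq_bigr => l _ /=.
(* Since [z ^+ (i * m) * x m] has period [n] in [m], the resolvent may be summed from [l] on; the
   factor [z ^+ (i * l)] that appears cancels the [l]-th power of [(z ^+ i)^-1]. *)
rewrite -(big_ord_shift _ (E := fun m => z ^+ (i * m) * x m) l); last first.
  move=> m; rewrite x_per mulnDr exprD (mulnC i n) (exprM z n) (prim_expr_order z_prim).
  by rewrite expr1n mulr1.
rewrite mulr_sumr; apply: eq_bigr => k _.
rewrite [(k + l)%N]addnC mulnDr exprD exprVn -exprM.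
rewrite -!mulrA mulrCA; congr (_ * _).
by rewrite mulKf // expf_neq0.
Qed.

(** * The Frobenius map and the roots of an irreducible polynomial *)

Section Frobenius.

Variables (F : finFieldType) (L : fieldExtType F).
Notation q := #|F|.

Lemma exprD_card (x y : L) : (x + y) ^+ q = x ^+ q + y ^+ q.
Proof.
have [p p_pr pF] := finPcharP F; have pL : p \in [pchar L] by rewrite pchar_lalg.
apply: exprDn_pchar; rewrite (card_pprimeChar pF) pnatX.
by apply/orP; left; rewrite (eq_pnat _ (pcharf_eq pL)) pnat_id.
Qed.

Definition frobenius_card (x : L) : L := x ^+ q.

Lemma frobenius_card_additive : zmod_morphism frobenius_card.
Proof.
move=> x y; apply/eqP; rewrite eq_sym subr_eq.
by rewrite /frobenius_card -exprD_card subrK.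
Qed.

Lemma frobenius_card_multiplicative : monoid_morphism frobenius_card.
Proof. by split=> [|x y]; rewrite /frobenius_card ?expr1n ?exprMn. Qed.

HB.instance Definition _ :=
  GRing.isZmodMorphism.Build L L frobenius_card frobenius_card_additive.
HB.instance Definition _ :=
  GRing.isMonoidMorphism.Build L L frobenius_card frobenius_card_multiplicative.

Lemma frobenius_card_alg (a : F) : frobenius_card a%:A = a%:A.
Proof. by rewrite /frobenius_card -(rmorphXn (in_alg L)) /= expf_card. Qed.

Lemma frobenius_cardZ (a : F) (x : L) :
  frobenius_card (a *: x) = a *: frobenius_card x.
Proof. by rewrite -mulr_algl rmorphM /= frobenius_card_alg mulr_algl. Qed.

(** A fixed point is a root of [X^q - X], which already splits over [F] as the product of all
    [X - a]. *)
Lemma frobenius_card_fixed (x : L) : frobenius_card x = x -> exists a, x = a%:A.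
Proof.
move=> x_fix; have := congr1 (map_poly (in_alg L)) (finField_genPoly F).
rewrite rmorphB rmorph_prod /= map_polyXn map_polyX => genE.
have /eqP : ('X^q - 'X : {poly L}).[x] = 0.
  by rewrite hornerD hornerN hornerXn hornerX [_ ^+ _]x_fix subrr.
rewrite genE horner_prod prodf_seq_eq0 => /hasP[a _ /=].
by rewrite map_polyXsubC hornerXsubC subr_eq0 => /eqP ->; exists a.
Qed.

Lemma frobenius_card_fixed_poly (p : {poly L}) :
  map_poly frobenius_card p = p -> exists p0, p = map_poly (in_alg L) p0.
Proof.
move=> p_fix.
have /fin_all_exists[c cE] (i : 'I_(size p)) : exists a, p`_i = a%:A.
  by apply: frobenius_card_fixed; rewrite -coef_map p_fix.
exists (\poly_(i < size p) (if insub i is Some j then c j else 0)).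
apply/polyP => i; rewrite coef_map coef_poly /=; case: ltnP => [i_lt|/(nth_default 0) ->].
  by rewrite insubT -cE.
by rewrite scale0r.
Qed.

(** The product of [X - s] over the Frobenius orbit of [r] has fixed coefficients, so it comes from
    a nonconstant monic divisor of [f] over [F]; by irreducibility that divisor is [f]. *)
Lemma irreducible_frobenius_roots (f : {poly F}) (r : L) :
    f \is monic -> irreducible_poly f -> root (map_poly (in_alg L) f) r ->
  exists2 n, iter n frobenius_card r = r &
    map_poly (in_alg L) f = \prod_(j < n) ('X - (iter j frobenius_card r)%:P).
Proof.
move=> f_monic f_irr r_root.
(* [finvect_type L] is [L] with its finite type structure, which orbits in [fingraph] require. *)
pose phi : finvect_type L -> finvect_type L := frobenius_card.
pose n := fingraph.order phi r.
pose s := [seq iter j frobenius_card r | j <- iota 0 n].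
have phi_inj : injective phi := @fmorph_inj _ _ frobenius_card.
have iter_n : iter n frobenius_card r = r := iter_order phi_inj r.
have s_uniq : uniq s.
  have := orbit_uniq phi r.
  suff -> : fingraph.orbit phi r = s by [].
  apply: (@eq_from_nth _ r) => [|j]; rewrite size_traject ?size_map ?size_iota //.
  by move=> j_lt; rewrite nth_traject // (nth_map 0) ?size_iota // nth_iota.
have s_root : all (root (map_poly (in_alg L) f)) s.
  apply/allP => _ /mapP[j _ ->]; elim: j => [//|j IHj] /=.
  have -> : map_poly (in_alg L) f =
      map_poly frobenius_card (map_poly (in_alg L) f).
    by apply/polyP => i; rewrite !coef_map /= frobenius_card_alg.
  by rewrite /root horner_map (eqP IHj) rmorph0.
exists n => //.
set g := \prod_(j < n) _.
have gE : g = \prod_(x <- s) ('X - x%:P).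
  rewrite big_map /g -(big_mkord xpredT (fun j => 'X - (iter j frobenius_card r)%:P)).
  by rewrite /index_iota subn0.
have g_fix : map_poly frobenius_card g = g.
  rewrite rmorph_prod.
  (* Frobenius moves each factor to the next one, cyclically. *)
  rewrite -[RHS](big_ord_shift _ (E := fun j => 'X - (iter j frobenius_card r)%:P) 1).
    by apply: eq_bigr => j _; rewrite /= map_polyXsubC addn1.
  by move=> m; rewrite iterD iter_n.
have [g0 g0E] := frobenius_card_fixed_poly g_fix.
have g_monic : g \is monic by rewrite gE monic_prod_XsubC.
have g0_monic : g0 \is monic by move: g_monic; rewrite g0E map_monic.
have size_g0 : size g0 != 1.
  rewrite -(size_map_poly (in_alg L)) -g0E gE size_prod_XsubC.
  by rewrite size_map size_iota eqSS -lt0n fingraph.order_gt0.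
have g0_dvd : g0 %| f.
  rewrite -(dvdp_map (in_alg L)) -g0E gE.
  have [|h ->] := uniq_roots_prod_XsubC s_root; first by rewrite uniq_rootsE.
  exact: dvdp_mulIr.
rewrite g0E; congr (map_poly _ _); apply/eqP; rewrite eq_sym -eqp_monic //.
by case: f_irr => _ /(_ _ size_g0 g0_dvd).
Qed.

End Frobenius.

Arguments frobenius_card {F L} x.

(** * The trinomial and the independence of its roots *)

Lemma rmorph_theta77_eval (F K : fieldType) (h : {rmorphism F -> K})
    (v : 'I_7 -> F) :
  h (theta77_eval v) = theta77_eval (h \o v).
Proof.
rewrite /theta77_eval -[map_mpoly (fun _ => _) theta77]/(map_mpoly intr theta77).
rewrite -[X in _ = X.@[_]]/(map_mpoly intr theta77).
rewrite (mpolyE theta77) !(raddf_sum (map_mpoly intr)) !(raddf_sum (meval _)).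
rewrite rmorph_sum; apply: eq_bigr => m _ /=.
rewrite !map_mpolyZ !mevalZ !map_mpolyX !mevalX rmorphM rmorph_int rmorph_prod.
by congr (_ * _); apply: eq_bigr => i _; rewrite rmorphXn.
Qed.

(** The order of [z] divides the prime [n]. Order 1 would give [z = 1] and turn the sum into [n = 0]
    in [R]. *)
Lemma geom_sum_prime_prim_root (R : idomainType) (n : nat) (z : R) :
    prime n -> n \notin [pchar R] -> \sum_(i < n) z ^+ i = 0 ->
  n.-primitive_root z.
Proof.
move=> n_pr charR z0.
have [m m_prim] := prim_order_exists (prime_gt0 n_pr) (expr_geom_sum_eq0 z0).
case/primeP: (n_pr) => _ /[apply] /orP[/eqP m1|/eqP <- //].
have z1 : z = 1 by rewrite -(prim_expr_order m_prim) m1 expr1.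
case/negP: charR; rewrite inE n_pr /=; move: z0.
rewrite z1 (eq_bigr (fun=> 1)) => [|i _]; last by rewrite expr1n.
by rewrite sumr_const card_ord => ->.
Qed.

(** The sign change is forced by the odd degree: at the roots themselves the first and last values
    would be -1 and [- b]. *)
Lemma mesym_trinomial (K : fieldType) (b : K) (x : 'I_7 -> K) (i : 'I_7) :
    'X^7 + 'X^6 + b%:P = \prod_(j < 7) ('X - (x j)%:P) ->
  (mesym 7 K i.+1).@[fun j => - x j] = pt_1_a b i.
Proof.
move=> fE; have [cs tnth_cs] :
    exists cs : 7.-tuple K, forall j, tnth cs j = - x j.
  by exists [tuple - x j | j < 7] => j; rewrite tnth_mktuple.
have csE : \prod_(c <- cs) ('X - c%:P) = 'X^7 - 'X^6 - b%:P.
  (* Substituting [- X] and negating turns the factors [X - x_j] into [X + x_j]. *)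
  have := congr1 (fun p => - (p \Po - 'X)) fE.
  rewrite rmorph_prod /= !rmorphD /= !rmorphXn /= comp_polyX comp_polyC.
  rewrite big_tuple => /esym.
  rewrite (eq_bigr (fun j : 'I_7 => - ('X - (tnth cs j)%:P))); last first.
    by move=> j _; rewrite tnth_cs rmorphB /= comp_polyX comp_polyC polyCN opprB addrC.
  rewrite prodrN card_ord !(exprNn 'X) -(signr_odd _ 7) -(signr_odd _ 6) /=.
  rewrite expr1 expr0 !mulN1r mul1r opprK.
  by move=> e; apply: (etrans e); rewrite !opprD opprK.
(* [lift ord0 i] is the index [i + 1] in ['I_8]. *)
have := mroots_coeff cs (lift ord0 i).
have -> : (mesym 7 K (lift ord0 i)).@[tnth cs] = (mesym 7 K i.+1).@[fun j => - x j].
  by apply: meval_eq => j; rewrite tnth_cs.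
move/(congr1 ( *%R ((-1) ^+ lift ord0 i))); rewrite signrMK => <-.
rewrite csE !coefD !coefN !coefXn coefC /pt_1_a -signr_odd.
case: i => [[|[|[|[|[|[|[|i]]]]]]] //=] _;
  by rewrite ?(expr1, expr0, mul1r, mulN1r, sub0r, subr0, oppr0, opprK).
Qed.

(** [K] is a common field for the roots, transported by [g], and for [z], which need not lie in
    [L]. *)
Lemma trinomial_roots_free (F : finFieldType) (L : fieldExtType F)
    (K : fieldType) (g : {rmorphism L -> K}) (z : K) (a : F) (rs : seq L) :
    7%N \notin [pchar F] -> \sum_(i < 7) z ^+ i = 0 ->
    irreducible_poly ('X^7 + 'X^6 + a%:P : {poly F}) ->
    theta77_eval (pt_1_a a) != 0 ->
    map_poly (in_alg L) ('X^7 + 'X^6 + a%:P) = \prod_(r <- rs) ('X - r%:P) ->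
  free rs.
Proof.
set f := 'X^7 + 'X^6 + a%:P => charF z0 f_irr theta_neq0 rsE.
pose h : {rmorphism F -> K} := g \o in_alg L.
have z_prim : 7.-primitive_root z.
  by apply: geom_sum_prime_prim_root => //; rewrite (fmorph_pchar h).
have size_f : size f = 8%N.
  by rewrite /f -addrA size_polyDl ?size_polyXn // size_XnaddC.
have f_monic : f \is monic.
  by rewrite monicE lead_coefE size_f /f !coefD !coefXn coefC /= !addr0.
have size_rs : size rs = 7%N.
  by apply/eqP; rewrite -eqSS -(size_prod_XsubC _ id) -rsE size_map_poly size_f.
have [r r_rs] : exists r, r \in rs.
  by case: (rs) size_rs => // r s _; exists r; rewrite mem_head.
have r_root : root (map_poly (in_alg L) f) r by rewrite rsE root_prod_XsubC.
have [n r_per fE] := irreducible_frobenius_roots f_monic f_irr r_root.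
have n7 : n = 7%N.
  apply/eqP; rewrite -eqSS -{1}[n]card_ord cardT /=.
  by rewrite -(size_prod_XsubC _ (fun j : 'I_n => iter j frobenius_card r))
    big_enum -fE size_map_poly size_f.
subst n; pose x m := g (iter m frobenius_card r).
pose rs' := [tuple iter j frobenius_card r | j < 7].
(* Both sequences factor the same polynomial, so they agree up to order. *)
have -> : free rs = free rs'.
  apply: perm_free; apply: prod_XsubC_eq; rewrite -rsE fE big_tuple.
  by apply: eq_bigr => j _; rewrite tnth_mktuple.
have hfE : 'X^7 + 'X^6 + (h a)%:P = \prod_(j < 7) ('X - (x j)%:P).
  transitivity (map_poly g (map_poly (in_alg L) f)).
    by rewrite /f !rmorphD /= !map_polyXn !map_polyC.
  by rewrite fE rmorph_prod; apply: eq_bigr => j _; rewrite /= map_polyXsubC.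
have mesymE i := mesym_trinomial i hfE.
have res_neq0 : resolvent_prod z (fun j : 'I_7 => - x j) != 0.
  apply: theta77_mesym_neq0 z0 _.
  have <- : h (theta77_eval (pt_1_a a)) =
      theta77_eval (fun i => (mesym 7 K i.+1).@[fun j : 'I_7 => - x j]).
    rewrite rmorph_theta77_eval; apply: meval_eq => i.
    by rewrite mesymE -[LHS]/(h (pt_1_a a i)) /pt_1_a !(fun_if h) rmorph0 rmorph1.
  by rewrite fmorph_eq0.
apply/freeP => k k_sum0 i; apply: (fmorph_inj h); rewrite rmorph0.
move: i; apply: (@resolvents_neq0_kernel _ _ z _ x) => // [m|m|i].
- by rewrite /x iterD r_per.
- have sumE : iter m frobenius_card (\sum_(i < 7) k i *: rs'`_i) =
      \sum_(i < 7) k i *: iter (i + m) frobenius_card r.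
    elim: m => [|m IHm].
      by apply: eq_bigr => i _; rewrite -tnth_nth tnth_mktuple addn0.
    rewrite iterS IHm raddf_sum; apply: eq_bigr => i _.
    by rewrite /= frobenius_cardZ addnS.
  transitivity (g (\sum_(i < 7) k i *: iter (i + m) frobenius_card r)).
    rewrite rmorph_sum; apply: eq_bigr => i _.
    by rewrite -[in RHS]mulr_algl rmorphM.
  suff sum0 : iter m frobenius_card (\sum_(i < 7) k i *: rs'`_i) = 0.
    by rewrite -sumE sum0 rmorph0.
  by rewrite k_sum0; elim: m {sumE} => //= m ->; rewrite rmorph0.
(* The resolvent of index 0 is absent from [resolvent_prod]; it is -1 by the value of the first
   elementary symmetric polynomial. *)
have [i0|i_gt0] := posnP i.
  have sum_x : - \sum_(m < 7) x m = 1.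
    rewrite -[RHS]/(pt_1_a (h a) ord0) -mesymE mesym1E (raddf_sum (meval _)) -sumrN.
    by apply: eq_bigr => m _; rewrite /= mevalXU.
  apply: contra_eq_neq sum_x => s0.
  suff -> : \sum_(m < 7) x m = 0 by rewrite oppr0 eq_sym oner_eq0.
  by apply: etrans s0; apply: eq_bigr => m _; rewrite i0 mul1r.
have /prodf_neq0/(_ i i_gt0) := res_neq0.
apply: contraNneq => s0; under eq_bigr do rewrite mulrN.
by rewrite sumrN s0 oppr0.
Qed.

Theorem theorem4p1 (F : finFieldType) (a : F) :
  (7%N \notin [pchar F]) ->
  irreducible_poly ('X^7 + 'X^6 + a%:P : {poly F}) ->
  theta77_eval (pt_1_a a) != 0 ->
  normal_poly ('X^7 + 'X^6 + a%:P : {poly F}).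
Proof.
move=> charF f_irr theta_neq0 L rs rsE.
(* An algebraic closure of [L] contains a root [z] of [1 + X + ... + X^6]; the finite copy of [L]
   provides the countability needed. *)
have [K [g _]] := countable_algebraic_closure (finvect_type L).
have [|z z_root] := closed_rootP (\poly_(i < 7) 1 : {poly K}) _.
  by rewrite size_poly_eq ?oner_eq0.
have z0 : \sum_(i < 7) z ^+ i = 0.
  move/rootP: z_root; rewrite horner_poly => z_root; apply: etrans z_root.
  by apply: eq_bigr => i _; rewrite mul1r.
exact: (@trinomial_roots_free F (finvect_type L) K g z a rs).
Qed.
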